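(* Consider the ICF-NCG with cost parameter $\alpha$ and exactly $k=2$ agent types, blue and red, with nonempty agent sets $V_B$ and $V_R$ of sizes $n_B\le n_R$. Let $\frac{n_R}{n_R+1}<\alpha<1$ and let $G$ be a pairwise stable network on $V=V_B\cup V_R$. Then any two distinct blue agents are adjacent in $G$, the bichromatic edges of $G$ form a matching of size $n_B$, and every curious red agent is adjacent in $G$ to all other red agents.
   Context: A network is a finite simple undirected graph $G=(V,E)$ on the set $V$ of agents; $V$ is the disjoint union of the types $V_B$ and $V_R$. An edge is bichromatic if its endpoints have different types. An agent is curious in $G$ if it is an endpoint of a bichromatic edge of $G$. For $u\in V$: $\deg_G(u)$ is its degree, $f_G(u)$ is the number of neighbors of $u$ having the same type as $u$, and $d_G(u)=\sum_{v\in V}d_G(u,v)$ is the sum of graph distances from $u$ to all agents ($=\infty$ if $G$ is disconnected). In the ICF-NCG (network creation game with increasing comfort among friends) with parameter $\alpha>0$, the cost of agent $u$ in $G$ is $$c_G(u)=\deg_G(u)\cdot\alpha\left(1+\frac{1}{f_G(u)+1}\right)+d_G(u).$$ A network $G=(V,E)$ is pairwise stable if it is connected and (i) for every agent $u$ and every neighbor $v$ of $u$, $c_G(u)\le c_{G-uv}(u)$; and (ii) for all distinct non-adjacent agents $u,v$, $c_G(u)\le c_{G+uv}(u)$ or $c_G(v)\le c_{G+uv}(v)$. *)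

(* Defs.v *)
From HB Require Import structures.
From mathcomp Require Import all_boot all_order all_algebra.
From mathcomp Require Import constructive_ereal reals.

Set Implicit Arguments.
Unset Strict Implicit.
Unset Printing Implicit Defensive.

Import Order.TTheory GRing.Theory Num.Theory.

Local Open Scope ring_scope.

Variant color := Blue | Red.

Definition bool_of_color (c : color) : bool := if c is Blue then true else false.
Definition color_of_bool (b : bool) : color := if b then Blue else Red.
Lemma bool_of_colorK : cancel bool_of_color color_of_bool.
Proof. by case. Qed.
HB.instance Definition _ := Equality.copy color (can_type bool_of_colorK).

(* A network on the agent set V is its adjacency relation. *)
Definition simple_graph (V : finType) (G : rel V) : Prop :=
  symmetric G /\ irreflexive G.

Definition connected (V : finType) (G : rel V) : Prop :=
  forall u v : V, connect G u v.

Definition add_edge (V : finType) (G : rel V) (u v : V) : rel V :=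
  [rel x y | G x y || ([set x; y] == [set u; v])].

Definition del_edge (V : finType) (G : rel V) (u v : V) : rel V :=
  [rel x y | G x y && ([set x; y] != [set u; v])].

Definition has_walk (V : finType) (G : rel V) (u v : V) (n : nat) : bool :=
  [exists p : n.-tuple V, path G u p && (last u p == v)].

(* The least length of a walk from u to v when there is one (a shortest walk
   repeats no vertex, so it has fewer than #|V| edges), and #|V| otherwise. *)
Definition walk_dist (V : finType) (G : rel V) (u v : V) : nat :=
  find (has_walk G u v) (iota 0 #|V|).

Definition dist (R : realType) (V : finType) (G : rel V) (u v : V) : \bar R :=
  if connect G u v then ((walk_dist G u v)%:R)%:E else +oo%E.

Definition sum_dist (R : realType) (V : finType) (G : rel V) (u : V) : \bar R :=
  (\sum_(v : V) dist R G u v)%E.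

Definition degree (V : finType) (G : rel V) (u : V) : nat :=
  #|[set v | G u v]|.

Definition friends (V : finType) (ty : V -> color) (G : rel V) (u : V) : nat :=
  #|[set v | G u v & ty v == ty u]|.

Definition cost (R : realType) (alpha : R) (V : finType) (ty : V -> color)
    (G : rel V) (u : V) : \bar R :=
  (((degree G u)%:R * (alpha * (1 + 1 / ((friends ty G u)%:R + 1))))%:E
   + sum_dist R G u)%E.

Definition pairwise_stable (R : realType) (alpha : R) (V : finType)
    (ty : V -> color) (G : rel V) : Prop :=
  [/\ connected G,
      forall u v : V, G u v ->
        (cost alpha ty G u <= cost alpha ty (del_edge G u v) u)%E
    & forall u v : V, u != v -> ~~ G u v ->
        (cost alpha ty G u <= cost alpha ty (add_edge G u v) u)%E \/
        (cost alpha ty G v <= cost alpha ty (add_edge G u v) v)%E].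

Definition agents (V : finType) (ty : V -> color) (c : color) : {set V} :=
  [set u | ty u == c].

Definition bichromatic_edges (V : finType) (ty : V -> color) (G : rel V) :
    {set {set V}} :=
  [set [set p.1; p.2] | p : V * V & G p.1 p.2 && (ty p.1 != ty p.2)].

Definition curious (V : finType) (ty : V -> color) (G : rel V) (u : V) : bool :=
  [exists e in bichromatic_edges ty G, u \in e].

Definition is_matching (V : finType) (M : {set {set V}}) : Prop :=
  forall e f : {set V}, e \in M -> f \in M -> e != f -> [disjoint e & f].

(* Main.v *)
(* A gain of 2 in total distance pays for any new edge, so G has diameter at most
   2, and a curious agent always wants one more friend, so curious agents of the
   same type are pairwise adjacent. In diameter 2 a non-curious agent reaches
   the other type through friends, so every agent of the other type is curious.
   A bichromatic edge costs more than 1 by the lower bound on alpha, hence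
   deleting it must increase the total distance by at least 2; this rules out
   two bichromatic edges sharing an endpoint. Finally, a non-curious blue agent
   would force the n_R red agents to be matched injectively into fewer than
   n_B <= n_R curious blue agents. *)
Require Import Defs.
From HB Require Import structures.
From mathcomp Require Import all_boot all_order all_algebra.
From mathcomp Require Import constructive_ereal reals.
From mathcomp Require Import zify ring lra.

Set Implicit Arguments.
Unset Strict Implicit.
Unset Printing Implicit Defensive.

Import Order.TTheory GRing.Theory Num.Theory.

Local Open Scope ring_scope.


(** * Walks, distances, and the effect of one edge on total distance *)

Section Walks.
Variables (V : finType).
Implicit Types (G : rel V) (u v w : V).

Lemma has_walkP G u v n :
  reflect (exists p : seq V, [/\ size p = n, path G u p & last u p = v])
          (has_walk G u v n).
Proof.
apply: (iffP existsP) => [[p /andP[Gp /eqP lp]]|[p [<- Gp <-]]].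
  by exists p; rewrite size_tuple.
by exists (in_tuple p); rewrite Gp eqxx.
Qed.

Lemma has_walk_connect G u v n : has_walk G u v n -> connect G u v.
Proof. by case/has_walkP => p [_ Gp <-]; apply/connectP; exists p. Qed.

Lemma walk_dist_le G u v n : has_walk G u v n -> (walk_dist G u v <= n)%N.
Proof.
move=> wn; rewrite /walk_dist leqNgt; apply/negP => lt_n.
have ltnV : (n < #|V|)%N.
  by have:= find_size (has_walk G u v) (iota 0 #|V|); rewrite size_iota; lia.
by have := before_find 0%N lt_n; rewrite nth_iota // add0n wn.
Qed.

(** A walk shortened to a duplicate-free path has fewer than [#|V|] edges, so the search succeeds
    and [find] does not return its default. *)
Lemma has_walk_dist G u v :
  connect G u v -> has_walk G u v (walk_dist G u v).
Proof.
case/connectP => p /shortenP[q Gq uq _] ->.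
have ltq : (size q < #|V|)%N.
  by have := max_card (mem (u :: q)); rewrite (card_uniqP uq).
have hs : has (has_walk G u (last u q)) (iota 0 #|V|).
  apply/hasP; exists (size q); first by rewrite mem_iota add0n.
  by apply/has_walkP; exists q.
have := nth_find 0%N hs; rewrite nth_iota ?add0n //.
by rewrite -[X in (_ < X)%N](size_iota 0) -has_find.
Qed.

Lemma has_walk0 G u v : has_walk G u v 0 = (u == v).
Proof.
apply/has_walkP/eqP => [[p [/size0nil-> _ /= ->]] //|<-].
by exists [::].
Qed.

Lemma has_walk1 G u v : has_walk G u v 1 = G u v.
Proof.
apply/has_walkP/idP => [[p []]|Guv].
  by case: p => [|x [|y p]] //= _; rewrite andbT => ? <-.
by exists [:: v]; rewrite /= Guv.
Qed.

Lemma has_walk2P G u v :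
  reflect (exists2 t, G u t & G t v) (has_walk G u v 2).
Proof.
apply: (iffP (has_walkP _ _ _ _)) => [[p []]|[t ut tv]].
  by case: p => [|x [|y [|z p]]] //= _; rewrite andbT => /andP[ux xy] <-; exists x.
by exists [:: t; v]; rewrite /= ut tv.
Qed.

Lemma has_walk_sub G H u v n :
  subrel G H -> has_walk G u v n -> has_walk H u v n.
Proof.
move=> sGH /has_walkP[p [sp Gp lp]]; apply/has_walkP.
by exists p; split=> //; apply: sub_path Gp.
Qed.

Lemma walk_dist_ge2 G u v :
  connect G u v -> u != v -> ~~ G u v -> (2 <= walk_dist G u v)%N.
Proof.
move=> /has_walk_dist; case: (walk_dist G u v) => [|[|//]].
  by rewrite has_walk0 => ->.
by rewrite has_walk1 => ->.
Qed.

Definition total_dist G u : nat := (\sum_v walk_dist G u v)%N.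

Lemma sum_distE (R : realType) G u :
  (forall v, connect G u v) -> sum_dist R G u = ((total_dist G u)%:R)%:E.
Proof.
move=> cG; rewrite /sum_dist /total_dist natr_sum -sumEFin.
by apply: eq_bigr => v _; rewrite /dist cG.
Qed.

Lemma add_edgeC G u v : add_edge G u v = add_edge G v u.
Proof. by rewrite /add_edge setUC. Qed.

Lemma eq_set2l u v w : ([set u; v] == [set u; w]) = (v == w).
Proof.
apply/eqP/eqP => [E|-> //].
have: v \in [set u; w] by rewrite -E set22.
have: w \in [set u; v] by rewrite E set22.
by move=> /set2P[] -> // /set2P[] ->.
Qed.

Lemma sub_add_edge G u v : subrel G (add_edge G u v).
Proof. by move=> x y /= Gxy; rewrite /add_edge /= Gxy. Qed.

Lemma add_edge_l G u v w : add_edge G u v u w = G u w || (w == v).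
Proof. by rewrite /add_edge /= eq_set2l. Qed.

Lemma del_edge_l G u v w : del_edge G u v u w = G u w && (w != v).
Proof. by rewrite /del_edge /= eq_set2l. Qed.

(** The distance to [v] drops to at most 1, which accounts for the [.-1]; no other distance
    grows. *)
Lemma total_dist_add G u v : connected G -> u != v -> ~~ G u v ->
  (total_dist (add_edge G u v) u + (walk_dist G u v).-1 <= total_dist G u)%N.
Proof.
move=> cG nuv nGuv; rewrite /total_dist (bigD1 v) //= [leqRHS](bigD1 v) //=.
have le1 : (walk_dist (add_edge G u v) u v <= 1)%N.
  by apply: walk_dist_le; rewrite has_walk1 add_edge_l eqxx orbT.
have ge2 := walk_dist_ge2 (cG u v) nuv nGuv.
have : (\sum_(w | w != v) walk_dist (add_edge G u v) u w <=
        \sum_(w | w != v) walk_dist G u w)%N.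
  apply: leq_sum => w _; apply: walk_dist_le.
  exact: has_walk_sub (@sub_add_edge G u v) (has_walk_dist (cG u w)).
lia.
Qed.

(** Only the distance to [v] grows, from 1 to 2: other neighbors of [u] keep their edge, and the
    detours avoiding [v] serve everyone else at distance 2. *)
Lemma total_dist_del G u v : connected G -> irreflexive G -> G u v ->
  (forall z, z != u -> (z == v) || ~~ G u z ->
     exists t, [/\ t != v, G u t & G t z]) ->
  (forall z, connect (del_edge G u v) u z) /\
  (total_dist (del_edge G u v) u <= (total_dist G u).+1)%N.
Proof.
move=> cG iG Guv detour.
have nuv : u != v by apply: contraTneq Guv => <-; rewrite iG.
have hw z : has_walk (del_edge G u v) u z (walk_dist G u z + (z == v))%N.
  have [->|nzu] := eqVneq z u.
    rewrite (negPf nuv) addn0.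
    suff /eqP-> : walk_dist G u u == 0%N by rewrite has_walk0.
    by rewrite -leqn0; apply: walk_dist_le; rewrite has_walk0.
  case: (boolP ((z == v) || ~~ G u z)) => [far|]; last first.
    rewrite negb_or negbK => /andP[nzv Guz]; rewrite (negPf nzv) addn0.
    suff /eqP-> : walk_dist G u z == 1%N.
      by rewrite has_walk1 del_edge_l Guz.
    rewrite eqn_leq walk_dist_le ?has_walk1 //=.
    have := has_walk_dist (cG u z); case: walk_dist => //.
    by rewrite has_walk0 eq_sym (negPf nzu).
  have [t [ntv Gut Gtz]] := detour z nzu far.
  have ntu : t != u by apply: contraTneq Gut => ->; rewrite iG.
  have w2 : has_walk (del_edge G u v) u z 2.
    apply/has_walk2P; exists t; rewrite ?del_edge_l ?Gut //=.
    (* The second edge of the detour is not the deleted one, since [t] is neither [u] nor [v]. *)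
    rewrite /del_edge /= Gtz /=; apply: contraNneq ntu => E.
    have: t \in [set u; v] by rewrite -E set21.
    by rewrite !inE (negPf ntv) orbF.
  suff -> : (walk_dist G u z + (z == v) = 2)%N by [].
  have [zv|nzv] := eqVneq z v.
    rewrite zv; suff /eqP-> : walk_dist G u v == 1%N by [].
    rewrite eqn_leq walk_dist_le ?has_walk1 //=.
    have := has_walk_dist (cG u v); case: walk_dist => //.
    by rewrite has_walk0 (negPf nuv).
  rewrite (negPf nzv) /= in far; apply/eqP; rewrite addn0 eqn_leq.
  rewrite walk_dist_ge2 //; last by rewrite eq_sym.
  by rewrite walk_dist_le //; apply/has_walk2P; exists t.
split=> [z|]; first exact: has_walk_connect (hw z).
rewrite /total_dist.
apply: (@leq_trans (\sum_z (walk_dist G u z + (z == v)))%N).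
  by apply: leq_sum => z _; apply: walk_dist_le.
by rewrite big_split /= -big_mkcond /= big_pred1_eq addn1.
Qed.

End Walks.

(** * Price inequalities over a real field *)

(* With e = d - f the bichromatic degree, the new edge costs
   alpha * (1 + (1 - e) / ((f + 1) * (f + 2))). *)
Lemma friend_price_lt (R : realFieldType) (alpha f d k : R) :
  0 < alpha -> alpha < 1 -> 0 <= f -> f <= d ->
  2 <= k \/ 1 <= k /\ f + 1 <= d ->
  (d + 1) * (alpha * (1 + 1 / (f + 1 + 1))) <
  d * (alpha * (1 + 1 / (f + 1))) + k.
Proof.
move=> alpha_gt0 alpha_lt1 f0 fd hk; set r : R := ((f + 1) * (f + 1 + 1))^-1.
have r0 : 0 < r by rewrite invr_gt0 mulr_gt0 //; lra.
have r2 : r <= 2^-1 by rewrite lef_pV2 ?posrE ?mulr_gt0 //; nra.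
have -> : (d + 1) * (alpha * (1 + 1 / (f + 1 + 1))) =
  d * (alpha * (1 + 1 / (f + 1))) + alpha * (1 + r * (f + 1 - d)).
  by rewrite /r; field; apply/andP; split; apply: lt0r_neq0; lra.
(* The factor of [alpha] is at most 3/2 when [f <= d], and at most 1 when [f + 1 <= d]. *)
rewrite ltrD2l; case: hk => [k2|[k1 ed]].
  have : r * (f + 1 - d) <= 2^-1 by nra.
  rewrite -(lerD2l 1) -(ler_pM2l alpha_gt0) => ?; lra.
have : r * (f + 1 - d) <= 0 by nra.
rewrite -(lerD2l 1) -(ler_pM2l alpha_gt0) => ?; lra.
Qed.

Lemma bichromatic_price_lt2 (R : realFieldType) (alpha f : R) :
  0 < alpha -> alpha < 1 -> 0 <= f -> alpha * (1 + 1 / (f + 1)) < 2.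
Proof.
move=> alpha_gt0 alpha_lt1 f0; have : 1 / (f + 1) <= 1 by rewrite ler_pdivrMr; lra.
by rewrite -(lerD2l 1) -(ler_pM2l alpha_gt0) => ?; lra.
Qed.

(** The factor [(f + 2) / (f + 1)] decreases in [f], so it is at least [(n + 1) / n], the reciprocal
    of the lower bound on [alpha]. *)
Lemma bichromatic_price_gt1 (R : realFieldType) (alpha f n : R) :
  0 <= f -> f + 1 <= n -> n / (n + 1) < alpha -> 1 < alpha * (1 + 1 / (f + 1)).
Proof.
move=> f0 fn an; have -> : 1 + 1 / (f + 1) = (f + 1 + 1) / (f + 1).
  by field; apply: lt0r_neq0; lra.
rewrite ltr_pdivrMr in an; last lra.
by rewrite mulrA ltr_pdivlMr; nra.
Qed.

(** * Profitable additions and deletions of an edge *)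

Section Costs.
Variables (R : realType) (alpha : R) (V : finType) (ty : V -> color).
Variable G : rel V.
Hypotheses (alpha_gt0 : 0 < alpha) (alpha_lt1 : alpha < 1).
Hypotheses (simpleG : simple_graph G).
Implicit Types u v : V.

Let symG : symmetric G. Proof. by case: simpleG. Qed.
Let irrG : irreflexive G. Proof. by case: simpleG. Qed.

Lemma costE H u : (forall v, connect H u v) ->
  cost alpha ty H u =
  ((degree H u)%:R * (alpha * (1 + 1 / ((friends ty H u)%:R + 1)))
    + (total_dist H u)%:R)%:E.
Proof. by move=> cH; rewrite /cost sum_distE. Qed.

Lemma curiousP u :
  reflect (exists2 w, G u w & ty w != ty u) (curious ty G u).
Proof.
apply: (iffP exists_inP) => [[e /imsetP[[x y]]]|[w Guw tw]].
  rewrite inE /= => /andP[Gxy txy] -> /set2P[] ->; first by exists y; rewrite 1?eq_sym.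
  by exists x; rewrite 1?symG.
exists [set u; w]; last exact: set21.
by apply/imsetP; exists (u, w); rewrite ?inE //= Guw eq_sym.
Qed.

Lemma degree_add u v : ~~ G u v -> degree (add_edge G u v) u = (degree G u).+1.
Proof.
move=> nG; rewrite /degree -[RHS]add1n.
have -> : [set w | add_edge G u v u w] = v |: [set w | G u w].
  by apply/setP => w; rewrite !inE add_edge_l orbC.
by rewrite cardsU1 inE nG.
Qed.

Lemma friends_add u v : ~~ G u v ->
  friends ty (add_edge G u v) u = (friends ty G u + (ty v == ty u))%N.
Proof.
move=> nG; rewrite /friends addnC.
have [tE|tN] := eqVneq (ty v) (ty u).
  have -> : [set w | add_edge G u v u w & ty w == ty u] =
            v |: [set w | G u w & ty w == ty u].
    apply/setP => w; rewrite !inE add_edge_l.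
    by have [->|_] := eqVneq w v; rewrite ?tE ?eqxx ?orbT ?orbF.
  by rewrite cardsU1 inE (negPf nG).
apply: eq_card => w; rewrite !inE add_edge_l.
by have [->|_] := eqVneq w v; rewrite ?(negPf tN) ?andbF ?orbF.
Qed.

Lemma degree_del u v : G u v -> degree G u = (degree (del_edge G u v) u).+1.
Proof.
move=> Guv; rewrite /degree (cardsD1 v) inE Guv add1n; congr _.+1.
by apply: eq_card => w; rewrite !inE del_edge_l andbC.
Qed.

Lemma friends_del u v : ty v != ty u ->
  friends ty (del_edge G u v) u = friends ty G u.
Proof.
move=> tN; apply: eq_card => w; rewrite !inE del_edge_l.
by have [->|_] := eqVneq w v; rewrite ?(negPf tN) ?andbF ?andbT.
Qed.

Lemma friends_le_degree u : (friends ty G u <= degree G u)%N.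
Proof. by apply: subset_leq_card; apply/subsetP => w; rewrite !inE => /andP[]. Qed.

Lemma friends_lt_degree u : curious ty G u -> (friends ty G u < degree G u)%N.
Proof.
case/curiousP => w Guw tw; apply: proper_card; apply/properP; split.
  by apply/subsetP => z; rewrite !inE => /andP[].
by exists w; rewrite !inE Guw ?(negPf tw).
Qed.

Lemma friends_lt_agents u : (friends ty G u < #|agents ty (ty u)|)%N.
Proof.
apply: proper_card; apply/properP; split.
  by apply/subsetP => z; rewrite !inE => /andP[].
by exists u; rewrite !inE ?irrG.
Qed.

(** From distance 3 on, the gain of at least 2 exceeds any price. At distance 2 the gain of 1 still
    pays for a friend of a curious agent, whose bichromatic edges get cheaper as well. *)
Lemma add_edge_improves u v : connected G -> u != v -> ~~ G u v ->
  (3 <= walk_dist G u v)%N || ((ty v == ty u) && curious ty G u) ->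
  ~ (cost alpha ty G u <= cost alpha ty (add_edge G u v) u)%E.
Proof.
move=> cG nuv nG gain.
have cA w : connect (add_edge G u v) u w.
  have := cG u w; apply: connect_sub => x y Gxy.
  exact/connect1/sub_add_edge.
rewrite !costE // lee_fin degree_add // friends_add //.
have lefR : (friends ty G u)%:R <= (degree G u)%:R :> R.
  by rewrite ler_nat friends_le_degree.
have leSR : (total_dist (add_edge G u v) u)%:R + (walk_dist G u v).-1%:R
            <= (total_dist G u)%:R :> R.
  by rewrite -natrD ler_nat total_dist_add.
have ge2 := walk_dist_ge2 (cG u v) nuv nG.
have ge1R : 1 <= (walk_dist G u v).-1%:R :> R by rewrite ler1n; lia.
apply/negP; rewrite -ltNge -natr1.
have [tE|tN] := eqVneq (ty v) (ty u); last first.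
  rewrite (negPf tN) orbF in gain; rewrite addn0.
  have k2 : 2 <= (walk_dist G u v).-1%:R :> R by rewrite (ler_nat _ 2); lia.
  have := bichromatic_price_lt2 alpha_gt0 alpha_lt1 (ler0n R (friends ty G u)).
  by rewrite mulrDl mul1r; lra.
rewrite addn1 -natr1.
suff /(friend_price_lt alpha_gt0 alpha_lt1 (ler0n _ _) lefR) :
    (2 <= (walk_dist G u v).-1%:R :> R) \/
    1 <= (walk_dist G u v).-1%:R :> R /\
    (friends ty G u)%:R + 1 <= (degree G u)%:R :> R by lra.
case/orP: gain => [d3|/andP[_ cu]]; [left|right].
  by rewrite (ler_nat _ 2); lia.
by rewrite natr1 ler_nat friends_lt_degree.
Qed.

(** The deletion saves more than 1, while the detours limit the loss in distance to 1. An agent is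
    not its own friend, so [f + 1] is at most the size of its type. *)
Lemma del_edge_improves u v (n : R) : connected G ->
  n / (n + 1) < alpha -> #|agents ty (ty u)|%:R <= n ->
  G u v -> ty v != ty u ->
  (forall z, z != u -> (z == v) || ~~ G u z ->
     exists t, [/\ t != v, G u t & G t z]) ->
  ~ (cost alpha ty G u <= cost alpha ty (del_edge G u v) u)%E.
Proof.
move=> cG alpha_gt le_n Guv tN detour.
have [cD leS] := total_dist_del cG irrG Guv detour.
rewrite !costE // lee_fin (degree_del Guv) friends_del // -natr1.
have leSR : (total_dist (del_edge G u v) u)%:R <= (total_dist G u)%:R + 1 :> R.
  by rewrite natr1 ler_nat.
have lef : (friends ty G u)%:R + 1 <= n.
  by apply: le_trans le_n; rewrite natr1 ler_nat friends_lt_agents.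
have gt1 := bichromatic_price_gt1 (ler0n _ _) lef alpha_gt.
by apply/negP; rewrite -ltNge mulrDl mul1r; lra.
Qed.

End Costs.

(** * Structure of stable networks *)

Section Stable.
Variables (R : realType) (alpha : R) (V : finType) (ty : V -> color).
Variable G : rel V.
Hypotheses (alpha_gt0 : 0 < alpha) (alpha_lt1 : alpha < 1).
Hypotheses (simpleG : simple_graph G) (stableG : pairwise_stable alpha ty G).
Implicit Types u v w x y z : V.

Let symG : symmetric G. Proof. by case: simpleG. Qed.
Let irrG : irreflexive G. Proof. by case: simpleG. Qed.
Let connG : connected G. Proof. by case: stableG. Qed.

Lemma adjacent_neq u v : G u v -> u != v.
Proof. by apply: contraTneq => ->; rewrite irrG. Qed.

Lemma color_neq_trans (a b c : color) : b != a -> c != a -> b = c.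
Proof. by case: a; case: b; case: c. Qed.

Lemma curious_adjacent u v : curious ty G u -> curious ty G v ->
  ty u = ty v -> u != v -> G u v.
Proof.
move=> cu cv tE nuv; apply/contraT => nG; case: stableG => _ _ /(_ u v nuv nG) [].
  by move=> /add_edge_improves; case=> //; rewrite tE eqxx cu orbT.
rewrite add_edgeC => /add_edge_improves; case=> //; first by rewrite eq_sym.
  by rewrite symG.
by rewrite tE eqxx cv orbT.
Qed.

Lemma diam2 u v : u != v -> ~~ G u v -> exists2 t, G u t & G t v.
Proof.
move=> nuv nG; apply/has_walk2P.
have far x y : x != y -> ~~ G x y -> ~~ has_walk G x y 2 ->
    (3 <= walk_dist G x y)%N.
  move=> nxy nGxy nw; have := has_walk_dist (connG x y).
  have := walk_dist_ge2 (connG x y) nxy nGxy.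
  by case: walk_dist => [|[|[|]]] // _; rewrite (negPf nw).
apply/contraT => nw.
case: stableG => _ _ /(_ u v nuv nG) [].
  by move=> /add_edge_improves; case=> //; rewrite far.
have nvu : v != u by rewrite eq_sym.
have nGvu : ~~ G v u by rewrite symG.
rewrite add_edgeC => /add_edge_improves; case=> //; rewrite far //.
apply: contra nw => /has_walk2P[t vt tu].
by apply/has_walk2P; exists t; rewrite symG.
Qed.

Lemma neighbor_same_type u v : ~~ curious ty G u -> G u v -> ty v = ty u.
Proof.
by move=> ncu Guv; apply/eqP; apply: contraNT ncu => ?; 
  apply/(curiousP ty simpleG _); exists v.
Qed.

(** A two-step walk from [u] to [v] has its midpoint of the type of [u], so its second edge is
    bichromatic. *)
Lemma opposite_not_curious u v :
  ~~ curious ty G u -> ty v != ty u -> curious ty G v.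
Proof.
move=> ncu tN.
have nG : ~~ G u v by apply: contra tN => /(neighbor_same_type ncu)/eqP.
have nuv : u != v by apply: contraNneq tN => ->.
have [t ut tv] := diam2 nuv nG; apply/(curiousP ty simpleG _); exists t.
  by rewrite symG.
by rewrite (neighbor_same_type ncu ut) eq_sym.
Qed.

Variable n : R.
Hypotheses (le_n : forall c, #|agents ty c|%:R <= n).
Hypothesis (alpha_gt : n / (n + 1) < alpha).

(** Otherwise every agent that could lose from the deletion would have a detour, and deleting the
    edge would pay off for [u]. *)
Lemma bichromatic_needed u v : G u v -> ty v != ty u ->
  exists z, [/\ z != u, (z == v) || ~~ G u z &
    forall t, t != v -> G u t -> ~~ G t z].
Proof.
move=> Guv tN; have [_ /(_ u v Guv) le_del _] := stableG.
pose bad z := [&& z != u, (z == v) || ~~ G u z &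
  [forall t, (t != v) ==> (G u t ==> ~~ G t z)]].
have [z /and3P[nz fz /forallP nt]|no_bad] := pickP bad.
  by exists z; split=> // t ntv Gut; have := nt t; rewrite ntv Gut.
case: (del_edge_improves simpleG connG alpha_gt _ Guv tN _ le_del) => //.
move=> z nz fz; have := no_bad z; rewrite /bad nz fz /= => /negbT.
case/forallPn => t; rewrite 2!negb_imply negbK => /and3P[? ? ?].
by exists t.
Qed.

(* If u and x were both joined to w, then deleting uw would be too cheap for w
   unless some agent of u's type is not curious, and too cheap for u unless some
   agent of w's type is not curious; both cannot happen at once. *)
Lemma bichromatic_unique w u x : G w u -> G w x -> ty u != ty w ->
  ty x != ty w -> u = x.
Proof.
move=> Gwu Gwx tu tx; apply/eqP/contraT => nux.
have tux : ty u = ty x := color_neq_trans tu tx.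
have tw : ty w != ty u by rewrite eq_sym.
have nxu : x != u by rewrite eq_sym.
have Guw : G u w by rewrite symG.
have Gxw : G x w by rewrite symG.
have cu : curious ty G u by apply/(curiousP ty simpleG _); exists w.
have cx : curious ty G x by apply/(curiousP ty simpleG _); exists w => //; rewrite eq_sym.
have cw : curious ty G w by apply/(curiousP ty simpleG _); exists u.
have Gux := curious_adjacent cu cx tux nux.
(* No two-step walk from [w] to [z] avoids [u], and none from [u] to [z'] avoids [w]. The triangle
   [u], [w], [x] gives detours through [x], so [z] is not [u] and [z'] is not [w]. *)
have [z [zw zu zsep]] := bichromatic_needed Gwu tu.
have [z' [z'u z'w z'sep]] := bichromatic_needed Guw tw.
have ncz : ~~ curious ty G z /\ ty z = ty u.
  have nzu : z != u by apply: contraTneq (zsep x nxu Gwx) => ->; rewrite symG Gux.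
  rewrite (negPf nzu) /= in zu.
  have nwz : w != z by rewrite eq_sym.
  have nxz : x != z by apply: contraNneq zu => <-.
  (* If [z] has the type of [w], it is not curious, so a common neighbor with [w] has that type too
     and differs from [u]. If [z] has the type of [u] and is curious, [x] is a detour. *)
  have [tzw|tzw] := eqVneq (ty z) (ty w).
    have [t wt tz] := diam2 nwz zu.
    have ncz : ~~ curious ty G z.
      by apply: contra zu => cz; apply: curious_adjacent.
    have ntu : t != u.
      apply: contraNneq tu => <-.
      by rewrite -tzw (neighbor_same_type ncz) // symG.
    by have := zsep t ntu wt; rewrite tz.
  have tzu := color_neq_trans tzw tu; split=> //.
  apply: contra (zsep x nxu Gwx) => cz.
  by apply: curious_adjacent => //; rewrite -tux.
have ncz' : ~~ curious ty G z'.
  have nxw : x != w by rewrite eq_sym adjacent_neq.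
  have nz'w : z' != w by apply: contraTneq (z'sep x nxw Gux) => ->; rewrite negbK.
  rewrite (negPf nz'w) /= in z'w.
  have nuz' : u != z' by rewrite eq_sym.
  apply/negP => cz'.
  have [tz'|tz'] := eqVneq (ty z') (ty u).
    by move: z'w; rewrite curious_adjacent.
  (* The bichromatic neighbor [s] of [z'] is curious and of the type of [u], hence adjacent to [u]:
     a detour avoiding [w]. *)
  have [s z's ts] := curiousP ty simpleG _ cz'.
  have tsu : ty s = ty u by apply: (color_neq_trans ts); rewrite eq_sym.
  have cs : curious ty G s.
    by apply/(curiousP ty simpleG _); exists z'; rewrite 1?symG // eq_sym.
  have nus : u != s by apply: contraNneq z'w => ->; rewrite symG.
  have nsw : s != w by apply: contraNneq tw => <-; rewrite tsu.
  have := z'sep s nsw (curious_adjacent cu cs (esym tsu) nus).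
  by rewrite symG z's.
have [nc tz] := ncz.
(* With the type of [u], [z'] would be reached from [u] through a friend, not [w]. With the other
   type, it would be curious because [z] is not. *)
have [tz'|tz'] := eqVneq (ty z') (ty u).
  have nuz' : u != z' by rewrite eq_sym.
  have nGuz' : ~~ G u z'.
    have nxw : x != w by rewrite eq_sym adjacent_neq.
    case/orP: z'w => // /eqP z'w.
    by have := z'sep x nxw Gux; rewrite z'w Gxw.
  have [t ut tz't] := diam2 nuz' nGuz'.
  have ntw : t != w.
    apply: contraNneq tw => <-.
    by rewrite -tz' (neighbor_same_type ncz') // symG.
  by have := z'sep t ntw ut; rewrite tz't.
by move: ncz'; rewrite (opposite_not_curious nc) // tz.
Qed.

Lemma bichromatic_matching : is_matching (bichromatic_edges ty G).
Proof.
have edge_at e t : e \in bichromatic_edges ty G -> t \in e ->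
    exists s, [/\ e = [set t; s], G t s & ty s != ty t].
  case/imsetP => -[x y]; rewrite inE /= => /andP[Gxy txy] -> /set2P[] ->.
    by exists y; rewrite eq_sym.
  by exists x; rewrite setUC symG.
move=> e f eM fM; apply: contraNT => /pred0Pn[t /andP[/= te tf]].
have [s [-> Gts ts]] := edge_at e t eM te.
have [s' [-> Gts' ts']] := edge_at f t fM tf.
by rewrite (bichromatic_unique Gts Gts').
Qed.

End Stable.

(** * Counting mates and assembling the three claims *)

Theorem theorem4p3 (R : realType) (alpha : R) (V : finType) (ty : V -> color)
    (G : rel V)
    (VB_neq0 : agents ty Blue != set0)
    (VR_neq0 : agents ty Red != set0)
    (leBR : (#|agents ty Blue| <= #|agents ty Red|)%N)
    (alpha_gt0 : 0 < alpha)
    (alpha_gt : #|agents ty Red|%:R / (#|agents ty Red|%:R + 1) < alpha)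
    (alpha_lt1 : alpha < 1)
    (simpleG : simple_graph G)
    (stableG : pairwise_stable alpha ty G) :
  [/\ forall u v : V, u \in agents ty Blue -> v \in agents ty Blue ->
        u != v -> G u v,
      is_matching (bichromatic_edges ty G)
        /\ #|bichromatic_edges ty G| = #|agents ty Blue|
    & forall u v : V, u \in agents ty Red -> curious ty G u ->
        v \in agents ty Red -> v != u -> G u v].
Proof.
have [symG irrG] := simpleG; have connG : connected G by case: stableG.
set n : R := #|agents ty Red|%:R.
have le_n c : #|agents ty c|%:R <= n by case: c; rewrite ler_nat.
have uniq_nbr := bichromatic_unique alpha_gt0 alpha_lt1 simpleG stableG le_n alpha_gt.
have curP u := curiousP ty simpleG u.
pose opp u w := G u w && (ty w != ty u).
(* The default [u] is never met at a curious agent; there [uniq_nbr] makes the mate the only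
   bichromatic neighbor. *)
pose mate u := odflt u [pick w | opp u w].
have mateP u : curious ty G u -> G u (mate u) /\ ty (mate u) != ty u.
  case/curP => w Guw tw; rewrite /mate.
  by case: pickP => [v /andP[] //|/(_ w)]; rewrite /opp Guw tw.
have blue_curious b : b \in agents ty Blue -> curious ty G b.
  rewrite inE => /eqP tb; apply/contraT => ncb.
  have cR r : r \in agents ty Red -> curious ty G r.
    rewrite inE => /eqP tr.
    by apply: (opposite_not_curious alpha_gt0 alpha_lt1 simpleG stableG ncb); rewrite tr tb.
  (* Two red agents with the same mate are both bichromatic neighbors of it, hence equal. *)
  have inj : {in agents ty Red &, injective mate}.
    move=> r r' Rr Rr' E.
    have [Gr tr] := mateP r (cR r Rr); have [Gr' tr'] := mateP r' (cR r' Rr').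
    apply: (uniq_nbr (mate r)); first by rewrite symG.
    - by rewrite E symG.
    - by rewrite eq_sym.
    - by rewrite E eq_sym.
  have sub : mate @: agents ty Red \subset agents ty Blue :\ b.
    apply/subsetP => _ /imsetP[r Rr ->]; have [Gr tr] := mateP r (cR r Rr).
    move: (Rr); rewrite !inE => /eqP tR; rewrite tR in tr; apply/andP; split.
      apply: contraNneq ncb => <-; apply/curP; exists r; rewrite 1?symG //.
      by rewrite tR eq_sym.
    by case: (ty _) tr.
  have := subset_leq_card sub; rewrite card_in_imset // => leRB.
  have := cardsD1 b (agents ty Blue); rewrite inE tb eqxx => E.
  by move: leBR leRB; rewrite E add1n ltnNge => /negbTE ->.
split.
- move=> u v Bu Bv.
  apply: (curious_adjacent alpha_gt0 alpha_lt1 simpleG stableG); try exact: blue_curious.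
  by move: Bu Bv; rewrite !inE => /eqP-> /eqP->.
- split.
    exact: (bichromatic_matching alpha_gt0 alpha_lt1 simpleG stableG le_n alpha_gt).
  have -> : bichromatic_edges ty G = [set [set b; mate b] | b in agents ty Blue].
    apply/setP => e; apply/imsetP/imsetP => [[[x y]]|[b Bb ->]]; last first.
      have [Gb tb] := mateP b (blue_curious b Bb).
      by exists (b, mate b); rewrite ?inE //= Gb eq_sym.
    rewrite inE /= => /andP[Gxy txy] ->.
    (* Edges are unordered pairs, so the blue endpoint may be listed first. *)
    wlog Bx : x y Gxy txy / x \in agents ty Blue.
      move=> hw; have [Bx|Rx] := boolP (x \in agents ty Blue); first exact: hw.
      have [b Bb eb] : exists2 b, b \in agents ty Blue & [set y; x] = [set b; mate b].
        apply: hw; rewrite 1?symG 1?eq_sym //.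
        by move: Rx txy; rewrite !inE; case: (ty x); case: (ty y).
      by exists b => //; rewrite setUC.
    exists x => //; have [Gx tx] := mateP x (blue_curious x Bx).
    by rewrite (uniq_nbr x y (mate x)) // eq_sym.
  rewrite card_in_imset // => b b' Bb Bb' E.
  (* If [b'] were the mate of [b], it would not be blue. *)
  have [_ tb] := mateP b (blue_curious b Bb).
  have: b' \in [set b; mate b] by rewrite E set21.
  case/set2P => // E'; move: tb; rewrite -E'.
  by move: Bb Bb'; rewrite !inE => /eqP-> /eqP->.
move=> u v Ru cu Rv nvu.
have [Gm tm] := mateP u cu.
have tuv : ty u = ty v by move: Ru Rv; rewrite !inE => /eqP-> /eqP->.
have nmv : v != mate u by apply: contraNneq tm => <-; rewrite tuv.
have [cv|ncv] := boolP (curious ty G v).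
  by apply: (curious_adjacent alpha_gt0 alpha_lt1 simpleG stableG) => //; rewrite eq_sym.
(* A non-curious [v] reaches the mate of [u] through a red friend [t]; the mate has only one red
   neighbor, so [t] is [u]. *)
have nG : ~~ G v (mate u).
  by apply: contra ncv => Gvm; apply/curP; exists (mate u); rewrite -?tuv.
have [t vt tm'] := diam2 alpha_gt0 alpha_lt1 simpleG stableG nmv nG.
have tE : ty t = ty u by rewrite (neighbor_same_type simpleG ncv vt) tuv.
have -> : u = t.
  apply: (uniq_nbr (mate u)); rewrite 1?symG //; first by rewrite eq_sym.
  by rewrite tE eq_sym.
by rewrite symG.
Qed.
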